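(* Let $n \geq 2$ be an integer and let $D(2^n)$ be the dihedral group of order $2^{n+1}$ (the group of isometries of a regular $2^n$-gon). Then the powerful covering number of $D(2^n)$ is $\sigma_P(D(2^n)) = 2^{n-1}+1$.
   Context: For a group $G$ and a positive integer $k$, $G^k$ denotes the subgroup generated by $\{g^k \mid g\in G\}$, and $[G,G]$ is the commutator subgroup. A finite $p$-group $G$ ($p$ prime) is called powerful if either $p$ is odd and $[G,G]\subseteq G^p$, or $p=2$ and $[G,G]\subseteq G^4$. A cover of a group $G$ is a collection of proper subgroups of $G$ whose union is $G$. A powerful cover of a finite $p$-group $G$ is a cover of $G$ all of whose members are powerful groups. The powerful covering number $\sigma_P(G)$ is the smallest number of subgroups in a powerful cover of $G$. *)

(* Defs.v *)
From mathcomp Require Import all_boot all_fingroup all_solvable.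
Set Implicit Arguments.
Unset Strict Implicit.
Unset Printing Implicit Defensive.

Local Open Scope group_scope.

Definition power_subgroup (gT : finGroupType) (G : {set gT}) (k : nat) : {set gT} :=
  <<[set x ^+ k | x in G]>>.

Definition powerful (gT : finGroupType) (p : nat) (G : {group gT}) : bool :=
  [&& prime p, p.-group G
    & [~: G, G] \subset power_subgroup G (if p == 2 then 4 else p)].

Definition cover_of (gT : finGroupType) (G : {group gT})
    (C : {set {group gT}}) : bool :=
  [forall (H : {group gT} | H \in C), H \proper G]
  && (\bigcup_(H in C) (H : {set gT}) == G).

Definition powerful_cover (gT : finGroupType) (p : nat) (G : {group gT})
    (C : {set {group gT}}) : bool :=
  cover_of G C && [forall (H : {group gT} | H \in C), powerful p H].

(* The value is [None] when G has no powerful cover (e.g. when G is cyclic);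
   it does not depend on which minimal cover is picked. *)
Definition powerful_covering_number (gT : finGroupType) (p : nat)
    (G : {group gT}) : option nat :=
  omap (fun C : {set {group gT}} => #|C|)
    [pick C : {set {group gT}} | powerful_cover p G C
       && [forall (C' : {set {group gT}} | powerful_cover p G C'), #|C| <= #|C'|]].

(* Main.v *)
Require Import Defs.
From mathcomp Require Import all_boot all_fingroup all_solvable.

(** Let q = 2 ^ n, let X be the cyclic group of the q rotations and call the q
    elements outside X reflections: they have order 2 and invert X by
    conjugation.

    The key point is that a powerful subgroup H containing a reflection t meets
    X in at most two elements ([powerful_inverted_small]).  Indeed, if z
    generates the intersection of H and X, then [~ z, t] = z ^- 2 lies in
    [~: H, H], whereas every fourth power in H is a power of z ^+ 4 because
    reflections have trivial fourth power.  So z ^+ 2 is a power of its own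
    square, which in a 2-group forces z ^+ 2 = 1.  Since two reflections differ
    by a rotation, H then contains at most two reflections.

    For the lower bound ([powerful_cover_lower_bound]), in a powerful cover some
    member contains a generator of X; as q > 2 this member contains no
    reflection at all.  The q reflections are thus shared among the remaining
    members, each of which takes at most two of them, so that there are at least
    q / 2 = 2 ^ n.-1 further members.

    For the upper bound ([powerful_cover_upper_bound]), pair each reflection t
    with z * t, where z is the rotation of order 2.  As z is central,
    {1, z, t, z * t} is an abelian group; these 2 ^ n.-1 groups together with X
    cover the dihedral group.  Abelian 2-groups are powerful, and an abelian
    subgroup of a nonabelian group is proper. *)

Set Implicit Arguments.
Unset Strict Implicit.
Unset Printing Implicit Defensive.

Local Open Scope group_scope.

Lemma powerful_covering_numberE (gT : finGroupType) (p m : nat)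
    (G : {group gT}) (C : {set {group gT}}) :
    powerful_cover p G C -> #|C| <= m ->
    (forall C' : {set {group gT}}, powerful_cover p G C' -> m <= #|C'|) ->
  powerful_covering_number p G = Some m.
Proof.
move=> covC leCm lem; rewrite /powerful_covering_number.
case: pickP => [C0 /andP[covC0 /forall_inP minC0] | noC] /=.
  by congr Some; apply/eqP; rewrite eqn_leq lem // (leq_trans (minC0 _ covC)).
have /negP[] := noC C; rewrite covC; apply/forall_inP=> C' covC'.
exact: leq_trans leCm (lem _ covC').
Qed.

Lemma abelian_powerful (gT : finGroupType) (p : nat) (G : {group gT}) :
  prime p -> p.-group G -> abelian G -> powerful p G.
Proof.
by move=> p_pr pG; rewrite /powerful p_pr pG => /commG1P->; rewrite sub1G.
Qed.

(** The square w of z is a power of w ^+ 2, so w and w ^+ 2 generate the same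
    group and have the same order; for a 2-element this leaves only order 1. *)
Lemma expg2_in_expg4 (gT : finGroupType) (z : gT) :
  2.-elt z -> z ^+ 2 \in <[z ^+ 4]> -> z ^+ 2 = 1.
Proof.
move=> z2; rewrite (expgM z 2 2); set w := z ^+ 2 => ww; apply/eqP.
have ow : #[w ^+ 2] = #[w].
  by apply/eqP; rewrite eqn_dvd orderXdvd; apply: order_dvdG.
have: 2.-elt w by apply: mem_p_elt (mem_cycle z 2).
rewrite -order_eq1 => /p_natP[[|k] ow2]; first by rewrite ow2.
move/eqP: ow; rewrite orderXdiv ow2 ?dvdn_exp // expnS mulKn //.
by rewrite ltn_eqF // ltn_Pmull ?expn_gt0.
Qed.

(** Every commutator [~ z, t] = z ^- 2 must be a product of fourth powers, while
    the elements of H outside X contribute no fourth power: a powerful group of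
    dihedral shape is therefore tiny. *)
Lemma powerful_inverted_small (gT : finGroupType) (H X : {group gT}) :
    powerful 2 H -> cyclic (H :&: X) ->
    {in H :\: X, forall t, t ^+ 2 = 1} ->
    {in H :&: X & H :\: X, forall z t, z ^ t = z^-1} ->
  H :\: X != set0 -> #|H :&: X| <= 2.
Proof.
case/and3P=> _ pH /= sH'H4 /cyclicP[z defZ] invol inv /set0Pn[t tHX].
have Zz : z \in H :&: X by rewrite defZ cycle_id.
have [Hz Xz] := setIP Zz; have [Ht _] := setDP tHX.
rewrite defZ -orderE dvdn_leq // order_dvdn; apply/eqP.
apply: expg2_in_expg4; first exact: mem_p_elt pH Hz.
have sH4 : power_subgroup H 4 \subset <[z ^+ 4]>.
  rewrite gen_subG; apply/subsetP=> _ /imsetP[u Hu ->].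
  have [Xu | notXu] := boolP (u \in X); last first.
    by rewrite (expgM u 2 2) (invol u) ?inE ?notXu ?Hu // expg1n group1.
  have /cycleP[i ->] : u \in <[z]> by rewrite -defZ inE Hu.
  by rewrite -expgM mulnC expgM mem_cycle.
rewrite -groupV -expgVn; apply: (subsetP sH4); apply: (subsetP sH'H4).
by rewrite (_ : _ ^+ 2 = [~ z, t]) ?mem_commg // commgEl inv.
Qed.

(** The hypothesis puts the part of H outside X in one coset of the
    intersection of H and X. *)
Lemma card_setD_le_setI (gT : finGroupType) (H X : {group gT}) :
    {in H :\: X &, forall s t, s * t^-1 \in X} ->
  #|H :\: X| <= #|H :&: X|.
Proof.
move=> divX; have [->|[t tHX]] := set_0Vmem (H :\: X); first by rewrite cards0.
rewrite -(card_rcoset (H :&: X) t); apply/subset_leq_card/subsetP=> s sHX.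
rewrite mem_rcoset inE divX // andbT groupM ?groupV //.
  by case/setDP: sHX.
by case/setDP: tHX.
Qed.

Lemma leq_card_bigcup (I T : finType) (P : {pred I}) (A : I -> {set T}) :
  #|\bigcup_(i in P) A i| <= \sum_(i in P) #|A i|.
Proof.
elim/big_rec2: _ => [|i m B _ leB]; first by rewrite cards0.
by rewrite (leq_trans (leq_card_setU _ _)) // leq_add2l.
Qed.

(** The elements outside X are counted member by member: each member holds at
    most two of them, and the member K that contains a generator of X holds
    none, which accounts for the predecessor in the bound. *)
Lemma powerful_cover_lower_bound (gT : finGroupType) (G X : {group gT})
    (C : {set {group gT}}) :
    powerful_cover 2 G C -> X \subset G -> cyclic X -> 2 < #|X| ->
    {in G :\: X, forall t, t ^+ 2 = 1} ->
    {in X & G :\: X, forall z t, z ^ t = z^-1} ->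
    {in G :\: X &, forall s t, s * t^-1 \in X} ->
  #|G :\: X| <= 2 * #|C|.-1.
Proof.
case/andP=> /andP[_ /eqP covC] /forall_inP powC sXG cycX X_gt2 invol inv divX.
have sHG (H : {group gT}) : H \in C -> H \subset G.
  by move=> CH; rewrite -covC (bigcup_max H).
have sD (H : {group gT}) : H \in C -> H :\: X \subset G :\: X.
  by move=> CH; rewrite setSD ?sHG.
have small (H : {group gT}) : H \in C -> H :\: X != set0 -> #|H :&: X| <= 2.
  move=> CH; apply: powerful_inverted_small (powC H CH) _ _ _.
  - exact: cyclicS (subsetIr H X) cycX.
  - by move=> t tHX; apply/invol/(subsetP (sD H CH)).
  move=> z t /setIP[_ Xz] tHX; apply: inv => //; exact: (subsetP (sD H CH)).
have [x defX] := cyclicP cycX.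
have: x \in \bigcup_(H in C) (H : {set gT}).
  by rewrite covC (subsetP sXG) // defX cycle_id.
case/bigcupP=> K CK Kx; have sXK : X \subset K by rewrite defX cycle_subG.
have K0 : K :\: X = set0.
  apply: contraTeq X_gt2 => /(small K CK); rewrite (setIidPr sXK).
  by rewrite -leqNgt.
have sGC : G :\: X \subset \bigcup_(H in C :\ K) (H :\: X).
  apply/subsetP=> t /setDP[Gt notXt]; move: (Gt); rewrite -covC.
  case/bigcupP=> H CH Ht; apply/bigcupP; exists H; last by rewrite inE notXt.
  rewrite !inE CH andbT; apply: contraNneq notXt => defH.
  by move/eqP: K0; rewrite setD_eq0 => /subsetP-> //; rewrite -defH.
apply: leq_trans (subset_leq_card sGC) _.
apply: leq_trans (leq_card_bigcup _ _) _.
have -> : #|C|.-1 = #|C :\ K| by rewrite (cardsD1 K C) CK.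
rewrite mulnC -sum_nat_const; apply: leq_sum => H /setD1P[_ CH].
have [->|HX0] := eqVneq (H :\: X) set0; first by rewrite cards0.
apply: leq_trans (card_setD_le_setI _) (small H CH HX0).
by move=> s t sHX tHX; apply: divX; apply: (subsetP (sD H CH)).
Qed.

Lemma abelian_sub_proper (gT : finGroupType) (G H : {group gT}) :
  ~~ abelian G -> H \subset G -> abelian H -> H \proper G.
Proof.
move=> nabG sHG abH; rewrite properEneq sHG andbT.
by apply: contraNneq nabG => <-.
Qed.

(** The involution z = x ^+ k is central, so each group V i generated by z and
    x ^+ i * y is abelian; it also contains x ^+ (i + k) * y, hence the indices
    i < k suffice to cover G outside <[x]>.  An upper bound on the size of the
    cover avoids comparing the groups V i with one another. *)
Lemma powerful_cover_upper_bound (gT : finGroupType) (G : {group gT})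
    (k : nat) (x y : gT) :
    2.-group G -> ~~ abelian G -> x \in G ->
    #[x] = (2 * k)%N -> <[x]> :* y = G :\: <[x]> ->
    {in <[x]> & G :\: <[x]>, forall z t, z ^ t = z^-1} ->
  exists2 C : {set {group gT}}, powerful_cover 2 G C & #|C| <= k + 1.
Proof.
move=> pG nabG Gx ox defX' inv; pose z := x ^+ k.
have k_gt0 : 0 < k by have := order_gt0 x; rewrite ox muln_gt0; case/andP.
pose V (i : 'I_k) := (<[z]> <*> <[x ^+ i * y]>)%G.
pose C := <[x]>%G |: [set V i | i in 'I_k].
have X'V i : x ^+ i * y \in G :\: <[x]>.
  by rewrite -defX' mem_rcoset mulgK mem_cycle.
have Gz : z \in G by rewrite groupX.
have abC H : H \in C -> H \subset G /\ abelian H.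
  case/setU1P=> [-> | /imsetP[i _ ->]].
    by rewrite cycle_subG cycle_abelian.
  have /setDP[GVi _] := X'V i.
  rewrite join_subG !cycle_subG Gz GVi; split=> //.
  rewrite abelianY !cycle_abelian cycle_subG /= cent_cycle; apply/cent1P.
  (* Conjugation by [x ^+ i * y] inverts [z], which is its own inverse. *)
  rewrite /commute (conjgC z) inv ?mem_cycle ?X'V //; congr (_ * _).
  apply/eqP; rewrite eq_sym eq_invg_mul -expgD addnn -mul2n -ox.
  by rewrite expg_order.
exists C; last first.
  rewrite (leq_trans (leq_card_setU _ _)) // cards1 addnC leq_add2r.
  by rewrite (leq_trans (leq_imset_card _ _)) ?card_ord.
apply/andP; split; last first.
  by apply/forall_inP=> H /abC[sHG]; apply: abelian_powerful (pgroupS sHG pG).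
apply/andP; split.
  by apply/forall_inP=> H /abC[]; apply: abelian_sub_proper.
rewrite eqEsubset; apply/andP; split; first by apply/bigcupsP=> H /abC[].
apply/subsetP=> t Gt.
have [Xt | notXt] := boolP (t \in <[x]>).
  by apply/bigcupP; exists <[x]>%G; rewrite // !inE eqxx.
have: t \in <[x]> :* y by rewrite defX' inE notXt.
case/rcosetP=> _ /cycleP[j ->] ->.
pose i := Ordinal (ltn_pmod j k_gt0).
apply/bigcupP; exists (V i); first by rewrite inE imset_f ?orbT.
rewrite {1}(divn_eq j k) mulnC expgD expgM -mulgA.
by rewrite groupM ?mem_gen // inE ?mem_cycle ?cycle_id ?orbT.
Qed.

(* MathComp indexes dihedral groups by their order: the group of isometries of
   the regular 2^n-gon is 'D_(2 ^ n.+1). *)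
Theorem theorem4p11 (n : nat) (hn : (2 <= n)%N) :
  powerful_covering_number 2 'D_((2 ^ n.+1)%N)%G = Some (2 ^ n.-1 + 1)%N.
Proof.
have n1_gt1 : 1 < n.+1 by apply: ltnW.
set G : {group _} := ('D_((2 ^ n.+1)%N))%G.
have isoG : G \isog 'D_(2 ^ n.+1) by apply: isog_refl.
have [[x y] genG _] := generators_2dihedral n1_gt1 isoG.
have [[_ oX' inv] [defG' _ oG' _] _ _ _] :=
  dihedral2_structure n1_gt1 genG isoG.
have [pG _ _ _ _] := extremal_generators_facts (isT : prime 2) genG.
have [oG Gx ox X'y] := genG; rewrite /= in ox oG' oX' inv.
have sXG : <[x]> \subset G by rewrite cycle_subG.
have def2n : (2 ^ n = 2 * 2 ^ n.-1)%N by rewrite -expnS (ltn_predK hn).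
have iXG : #|G : <[x]>| = 2.
  by rewrite -divgS // oG -orderE ox expnS mulnK ?expn_gt0.
have defX' : <[x]> :* y = G :\: <[x]> by apply: rcoset_index2.
have nabG : ~~ abelian G.
  (* The derived subgroup has order 2 ^ n.-1, which exceeds 1. *)
  apply: contraL hn => /commG1P G'1; move: oG'.
  rewrite derg1 G'1 cards1 => /esym/eqP.
  by rewrite -(expn0 2) eqn_exp2l // -ltnNge -subn1 subn_eq0.
rewrite def2n in ox.
have [C covC leC] := powerful_cover_upper_bound pG nabG Gx ox defX' inv.
apply: (powerful_covering_numberE covC leC) => C' covC'.
have oX'2 : {in G :\: <[x]>, forall t, t ^+ 2 = 1}.
  by move=> t /oX' ot; have := expg_order t; rewrite ot.
have divX : {in G :\: <[x]> &, forall s t, s * t^-1 \in <[x]>}.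
  by move=> s t; rewrite -!defX' => Xs Xt; rewrite -mem_rcoset (rcoset_eqP Xt).
have X_gt2 : 2 < #|<[x]>|.
  by rewrite -orderE ox -def2n (@ltn_exp2l 2 1).
have cycX := cycle_cyclic x.
have := powerful_cover_lower_bound covC' sXG cycX X_gt2 oX'2 inv divX.
rewrite -defX' card_rcoset -orderE ox leq_pmul2l // addn1.
by case: #|C'| => //; rewrite leqNgt expn_gt0.
Qed.
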